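(* Let $k\ge 1$ be an integer. For every polynomial $h(x)\in\mathbb{C}_p[x]$, $$\underbrace{\int_{\mathbb{Z}_p}\cdots\int_{\mathbb{Z}_p}}_{k\text{ times}}w^{a_1+\cdots+a_k}h(a_1+\cdots+a_k+x)\prod_{j=1}^k\mathrm{d}\mu_{-1}(a_j)=\biggl(\frac{2}{we^{t}+1}\biggr)^kh(x).$$ In particular, for every $n\ge 0$, $$E_{n,w}^{(k)}(x)=\biggl(\frac{2}{we^{t}+1}\biggr)^kx^n=\Biggl(\int_{\mathbb{Z}_p}\cdots\int_{\mathbb{Z}_p}w^{a_1+\cdots+a_k}e^{(a_1+\cdots+a_k)t}\prod_{j=1}^k\mathrm{d}\mu_{-1}(a_j)\Biggr)x^n,$$ where the power series in $t$ act on polynomials in $x$ as differential operators. Consequently, $(E_{n,w}^{(k)}(x))_{n\ge 0}$ is the Sheffer sequence for $\Bigl(\bigl(\frac{we^{t}+1}{2}\bigr)^k,\,t\Bigr)$.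
   Context: Let $p$ be a fixed odd prime, $\mathbb{C}_p$ the completion of an algebraic closure of $\mathbb{Q}_p$ with absolute value normalized by $|p|_p=p^{-1}$, and let $w\in\mathbb{C}_p$ satisfy $|1-w|_p<1$. For a uniformly differentiable function $F:\mathbb{Z}_p\to\mathbb{C}_p$, the fermionic $p$-adic integral is $\int_{\mathbb{Z}_p}F(a)\,\mathrm{d}\mu_{-1}(a)=\lim_{N\to\infty}\sum_{a=0}^{p^N-1}F(a)(-1)^a$. Multiple integrals are iterated integrals; when the integrand is a polynomial in $x$ or a formal power series in $t$ whose coefficients depend on the $a_j$, the integral is taken coefficientwise (with $e^{(a_1+\cdots+a_k)t}=\sum_{n\ge0}(a_1+\cdots+a_k)^n\frac{t^n}{n!}$). The weighted Euler polynomials of order $k$, $E_{n,w}^{(k)}(x)$ ($n\ge 0$), are defined by the formal power series identity $\bigl(\frac{2}{we^t+1}\bigr)^ke^{xt}=\sum_{n=0}^\infty E_{n,w}^{(k)}(x)\frac{t^n}{n!}$. A formal power series $f(t)=\sum_{k\ge 0}a_k\frac{t^k}{k!}$ with coefficients in $\mathbb{C}_p$ acts as a linear operator on $\mathbb{C}_p[x]$ by letting $t^k$ act as $\frac{\mathrm{d}^k}{\mathrm{d}x^k}$, i.e. $f(t)h(x)=\sum_{k\ge0}\frac{a_k}{k!}h^{(k)}(x)$ (a finite sum), and as a linear functional by $\langle f(t)|x^n\rangle=a_n$ for all $n\ge 0$. For a series $g(t)$ with nonzero constant term and a series $f(t)$ with zero constant term and nonzero coefficient of $t$, the Sheffer sequence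 for $(g(t),f(t))$ is the unique sequence of polynomials $S_n(x)$ with $\deg S_n=n$ such that $\langle g(t)f(t)^m|S_n(x)\rangle=n!\,\delta_{n,m}$ for all $n,m\ge 0$. *)

(* Defs.v *)
From HB Require Import structures.
From mathcomp Require Import all_boot all_order all_algebra.
From mathcomp Require Import all_classical all_reals.

Set Implicit Arguments.
Unset Strict Implicit.
Unset Printing Implicit Defensive.

Import Order.TTheory GRing.Theory Num.Theory.

Local Open Scope ring_scope.

(* [f n] is the plain coefficient of t^n in f, so that *)
(* f = \sum_n a_n t^n / n! corresponds to f n = a_n / n! *)

Record fps (A : Type) := Fps { fps_coef :> nat -> A }.

HB.instance Definition _ (A : Type) := gen_eqMixin (fps A).
HB.instance Definition _ (A : Type) := gen_choiceMixin (fps A).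

Lemma fpsP (A : Type) (f g : fps A) : (forall n, f n = g n) -> f = g.
Proof. by case: f g => [f] [g] fg; congr Fps; apply/funext. Qed.

Section FpsZmod.
Context (A : zmodType).
Implicit Types f g h : fps A.

Definition fps_zero : fps A := Fps (fun=> 0).
Definition fps_opp f : fps A := Fps (fun n => - f n).
Definition fps_add f g : fps A := Fps (fun n => f n + g n).

Fact fps_addA : associative fps_add.
Proof. by move=> f g h; apply: fpsP => n /=; rewrite addrA. Qed.
Fact fps_addC : commutative fps_add.
Proof. by move=> f g; apply: fpsP => n /=; rewrite addrC. Qed.
Fact fps_add0 : left_id fps_zero fps_add.
Proof. by move=> f; apply: fpsP => n /=; rewrite add0r. Qed.
Fact fps_addN : left_inverse fps_zero fps_opp fps_add.
Proof. by move=> f; apply: fpsP => n /=; rewrite addNr. Qed.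

HB.instance Definition _ :=
  GRing.isZmodule.Build (fps A) fps_addA fps_addC fps_add0 fps_addN.

End FpsZmod.

Section FpsRing.
Context (A : comNzRingType).
Implicit Types f g h : fps A.

Definition fpsC (c : A) : fps A := Fps (fun n => if n == 0%N then c else 0).
Definition fps_mul f g : fps A :=
  Fps (fun n => \sum_(i < n.+1) f i * g (n - i)%N).

Let trunc n f : {poly A} := \poly_(i < n.+1) f i.

Let coef_trunc n f i : (i <= n)%N -> (trunc n f)`_i = f i.
Proof. by move=> le_in; rewrite coef_poly ltnS le_in. Qed.

Let fps_mulE n f g i : (i <= n)%N -> fps_mul f g i = (trunc n f * trunc n g)`_i.
Proof.
move=> le_in; rewrite coefM; apply: eq_bigr => -[j lt_ji] _ /=.
by rewrite !coef_trunc// (leq_trans _ le_in)// leq_subr.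
Qed.

Fact fps_mulC : commutative fps_mul.
Proof. by move=> f g; apply: fpsP => n; rewrite !(@fps_mulE n)// mulrC. Qed.

Fact fps_mulA : associative fps_mul.
Proof.
move=> f g h; apply: fpsP => n.
have ->: fps_mul f (fps_mul g h) n = (trunc n f * (trunc n g * trunc n h))`_n.
  rewrite coefM; apply: eq_bigr => -[j lt_jn] _ /=.
  by rewrite coef_trunc// -fps_mulE// leq_subr.
rewrite mulrA coefM; apply: eq_bigr => -[j lt_jn] _.
by rewrite (@fps_mulE n)//= coef_trunc// leq_subr.
Qed.

Fact fps_mul1 : left_id (fpsC 1) fps_mul.
Proof.
move=> f; apply: fpsP => n /=; rewrite big_ord_recl/= mul1r subn0 big1 ?addr0//.
by move=> i _; rewrite mul0r.
Qed.

Fact fps_mulDl : left_distributive fps_mul +%R.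
Proof.
move=> f g h; apply: fpsP => n /=; rewrite -big_split/=.
by apply: eq_bigr => i _; rewrite mulrDl.
Qed.

Fact fps_1neq0 : fpsC 1 != 0 :> fps A.
Proof.
by apply/eqP => /(congr1 (fun f : fps A => f 0%N))/eqP; rewrite (negPf (oner_neq0 _)).
Qed.

HB.instance Definition _ := GRing.Zmodule_isComNzRing.Build (fps A)
  fps_mulA fps_mulC fps_mul1 fps_mulDl fps_1neq0.

Lemma fps_coefD f g n : (f + g) n = f n + g n. Proof. by []. Qed.
Lemma fps_coefN f n : (- f) n = - f n. Proof. by []. Qed.
Lemma fps_coefM f g n : (f * g) n = \sum_(i < n.+1) f i * g (n - i)%N.
Proof. by []. Qed.
Lemma fps_coef1 n : (1 : fps A) n = (n == 0%N)%:R. Proof. by case: n. Qed.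
Lemma fps_coefCM c f n : (fpsC c * f) n = c * f n.
Proof.
rewrite fps_coefM big_ord_recl/= subn0 big1 ?addr0// => i _.
by rewrite mul0r.
Qed.

Lemma fps_coef_sum (I : Type) (r : seq I) (P : pred I) (F : I -> fps A) n :
  (\sum_(i <- r | P i) F i) n = \sum_(i <- r | P i) F i n.
Proof. by elim/big_rec2: _ => // i x y _ <-. Qed.

Lemma fps_coefX_small f m n : f 0%N = 0 -> (n < m)%N -> (f ^+ m) n = 0.
Proof.
move=> f0; elim: m n => // m IHm n; rewrite ltnS exprS fps_coefM => le_nm.
rewrite big1// => -[[|j] /= lt_jn] _; first by rewrite f0 mul0r.
by rewrite IHm ?mulr0// (leq_trans _ le_nm)// ltn_subrL/=; case: (n) lt_jn.
Qed.

End FpsRing.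

Section FpsUnitRing.
Context (A : comUnitRingType).
Implicit Types f g : fps A.

Definition fps_unit : pred (fps A) := fun f => f 0%N \is a GRing.unit.

(* f^-1 = f_0^-1 \sum_m (1 - f_0^-1 f)^m *)
Definition fps_inv f : fps A :=
  if f \in fps_unit then
    Fps (fun n => (f 0%N)^-1 * \sum_(m < n.+1) ((1 - fpsC (f 0%N)^-1 * f) ^+ m) n)
  else f.

Fact fps_mulVf : {in fps_unit, left_inverse 1 fps_inv *%R}.
Proof.
move=> f Uf; rewrite /fps_inv Uf mulrC.
set c := (f 0%N)^-1; set u := 1 - fpsC c * f.
have u0 : u 0%N = 0.
  by rewrite /u fps_coefD fps_coefN fps_coefCM fps_coef1 /c mulVr ?subrr.
apply: fpsP => n.
pose s : fps A := \sum_(m < n.+1) u ^+ m.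
transitivity ((fpsC c * f * s) n).
  rewrite [fpsC c * f]mulrC -mulrA !fps_coefM.
  apply: eq_bigr => -[i lt_in] _; rewrite fps_coefCM /s fps_coef_sum /=; congr (_ * (_ * _)).
  rewrite -(big_mkord xpredT (fun m => (u ^+ m) (n - i)%N)).
  rewrite -(big_mkord xpredT (fun m => (u ^+ m) (n - i)%N)).
  rewrite (@big_cat_nat _ _ _ (n - i).+1 0 n.+1) ?ltnS ?leq_subr//=.
  set z := (X in _ = _ + X); suff ->: z = 0 by rewrite addr0.
  rewrite /z big_nat; apply: big1 => m /andP[lt_m _].
  by rewrite fps_coefX_small.
have -> : fpsC c * f = 1 - u by rewrite /u opprB addrC subrK.
rewrite -opprB mulNr /s -subrX1 opprB fps_coefD fps_coefN.
by rewrite fps_coefX_small// subr0.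
Qed.

Fact fps_unitPl f g : g * f = 1 -> fps_unit f.
Proof.
move=> gf1; apply/unitrP; exists (g 0%N); rewrite mulrC.
have := congr1 (fun h : fps A => h 0%N) gf1.
by rewrite fps_coefM big_ord1 subn0 fps_coef1 mulrC => ->.
Qed.

Fact fps_inv_out : {in [predC fps_unit], fps_inv =1 id}.
Proof. by move=> f; rewrite inE /= /fps_inv => /negPf ->. Qed.

HB.instance Definition _ := GRing.ComNzRing_hasMulInverse.Build (fps A)
  fps_mulVf fps_unitPl fps_inv_out.

(* e^{ct} *)
Definition fps_exp (c : A) : fps A := Fps (fun n => c ^+ n / n`!%:R).

(* we^t *)
Definition fps_wexp (w : A) : fps A := fpsC w * fps_exp 1.

End FpsUnitRing.

Section Umbral.
Context (K : fieldType).
Implicit Types (f g : fps K) (h : {poly K}) (S : nat -> {poly K}).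

(* n! times the coefficient of t^n in (2 / (we^t + 1))^k e^{xt}, computed in *)
(* K[x][[t]] *)
Definition weighted_euler (w : K) (k n : nat) : {poly K} :=
  n`!%:R * ((2%:R / (fps_wexp w%:P + 1)) ^+ k * fps_exp 'X : fps {poly K}) n.

(* [h^`(i)] vanishes for [size h <= i] *)
Definition fps_act f h : {poly K} := \sum_(i < size h) f i *: h^`(i).

Definition fps_pair f h : K := \sum_(i < size h) h`_i * (i`!%:R * f i).

Definition is_sheffer g f S : Prop :=
  [/\ g 0%N != 0, f 0%N = 0 & f 1%N != 0] /\
  (forall n, size (S n) = n.+1) /\
  (forall n m, fps_pair (g * f ^+ m) (S n) = if n == m then n`!%:R else 0).

End Umbral.

Record absval (R : realType) (K : fieldType) := Absval {
  absv :> K -> R;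
  absv_ge0 : forall x, 0 <= absv x;
  absv_eq0 : forall x, absv x = 0 -> x = 0;
  absv_mul : forall x y, absv (x * y) = absv x * absv y;
  absv_ultra : forall x y, absv (x + y) <= Num.max (absv x) (absv y);
  absv_one : absv 1 = 1
}.

Definition padic_abs (R : realType) (p : nat) (x : rat) : R :=
  if x == 0 then 0 else
  p%:R ^ ((logn p `|denq x|)%:Z - (logn p `|numq x|)%:Z).

Record is_completion (R : realType) (K L : fieldType) (aK : K -> R)
    (aL : absval R L) (j : {rmorphism K -> L}) : Prop := IsCompletion {
  completion_isom : forall x, aL (j x) = aK x;
  completion_dense : forall (y : L) (e : R), 0 < e -> exists x, aL (y - j x) < e;
  completion_complete : forall u : nat -> L,
    (forall e : R, 0 < e -> exists N, forall m n,
       (N <= m)%N -> (N <= n)%N -> aL (u m - u n) < e) ->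
    exists l, forall e : R, 0 < e -> exists N, forall n,
      (N <= n)%N -> aL (u n - l) < e
}.

(* A tower Q -> Q_p -> closure of Q_p -> C_p. These conditions determine each *)
(* field and its absolute value up to isometric isomorphism. *)
Record padic_tower (R : realType) (p : nat) := PadicTower {
  Qp : fieldType;
  Qp_abs : absval R Qp;
  Qp_in : {rmorphism rat -> Qp};
  Qp_completion : is_completion (padic_abs R p) Qp_abs Qp_in;
  Qpbar : closedFieldType;
  Qpbar_abs : absval R Qpbar;
  Qpbar_in : {rmorphism Qp -> Qpbar};
  Qpbar_isom : forall x, Qpbar_abs (Qpbar_in x) = Qp_abs x;
  Qpbar_algebraic : forall z : Qpbar,
    exists2 P : {poly Qp}, P != 0 & root (map_poly Qpbar_in P) z;
  Cp : fieldType;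
  Cp_abs : absval R Cp;
  Cp_in : {rmorphism Qpbar -> Cp};
  Cp_completion : is_completion Qpbar_abs Cp_abs Cp_in
}.

Section PadicInt.
Context (R : realType) (p : nat) (T : padic_tower R p).

Definition padic_int_pred : {pred Qp T} := fun a => Qp_abs T a <= 1.

Fact padic_int_subring_closed : subring_closed padic_int_pred.
Proof.
split; first by rewrite unfold_in /padic_int_pred absv_one.
- move=> x y; rewrite !unfold_in /padic_int_pred => x1 y1.
  apply: le_trans (absv_ultra _ _ _) _; rewrite ge_max x1/=.
  have N1 : Qp_abs T (-1) = 1.
    have := absv_mul (Qp_abs T) (-1) (-1); rewrite mulrNN mulr1 absv_one.
    move/esym/eqP; rewrite -expr2 sqrf_eq1 => /orP[/eqP//|/eqP eN1].
    by have := absv_ge0 (Qp_abs T) (-1); rewrite eN1 lerNr oppr0 ler10.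
  by rewrite -mulN1r absv_mul N1 mul1r.
- move=> x y; rewrite !unfold_in /padic_int_pred => x1 y1.
  by rewrite absv_mul mulr_ile1 ?absv_ge0.
Qed.

HB.instance Definition _ :=
  GRing.isSubringClosed.Build (Qp T) padic_int_pred padic_int_subring_closed.

Record padic_int := PadicInt { padic_int_val : Qp T; _ : padic_int_val \in padic_int_pred }.

HB.instance Definition _ := [isSub for padic_int_val].
HB.instance Definition _ := [Choice of padic_int by <:].
HB.instance Definition _ := [SubChoice_isSubComNzRing of padic_int by <:].

Definition padic_int_abs (a : padic_int) : R := Qp_abs T (padic_int_val a).

Definition padic_int_in (a : padic_int) : Cp T := Cp_in T (Qpbar_in T (padic_int_val a)).

(* w^a as the limit of w^n for natural numbers n tending to a; the limit *)
(* exists (and is unique) when |1 - w|_p < 1 *)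
Definition padic_int_pow (w : Cp T) (a : padic_int) : Cp T :=
  xget 0 (fun l : Cp T => forall e : R, 0 < e -> exists2 d : R, 0 < d &
    forall n : nat, padic_int_abs (n%:R - a) < d -> Cp_abs T (w ^+ n - l) < e).

(* Integrals are rendered as relations: [is_fermionic F I] and its variants *)
(* assert that the integral of F exists and equals I. *)

(* By compactness of Z_p, this amounts to (F x - F y) / (x - y) having a *)
(* limit as (x, y) tends to (a, a), for every a in Z_p *)
Definition unif_differentiable (F : padic_int -> Cp T) : Prop :=
  exists F' : padic_int -> Cp T, forall e : R, 0 < e -> exists2 d : R, 0 < d &
    forall x y : padic_int, x != y -> padic_int_abs (x - y) < d ->
      Cp_abs T ((F x - F y) / padic_int_in (x - y) - F' y) < e.

Definition fermionic_sum (F : padic_int -> Cp T) (N : nat) : Cp T :=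
  \sum_(0 <= a < p ^ N) F a%:R * (-1) ^+ a.

Definition is_fermionic (F : padic_int -> Cp T) (I : Cp T) : Prop :=
  unif_differentiable F /\
  (forall e : R, 0 < e -> exists N0, forall N, (N0 <= N)%N ->
     Cp_abs T (fermionic_sum F N - I) < e).

Fixpoint is_multi_fermionic (k : nat) : (k.-tuple padic_int -> Cp T) -> Cp T -> Prop :=
  match k with
  | 0 => fun F I => F [tuple] = I
  | k'.+1 => fun F I => exists2 G : padic_int -> Cp T,
      forall a, is_multi_fermionic (fun s : k'.-tuple padic_int => F [tuple of a :: s]) (G a)
      & is_fermionic G I
  end.

Definition is_multi_fermionic_poly (k : nat)
    (F : k.-tuple padic_int -> {poly Cp T}) (I : {poly Cp T}) : Prop :=
  forall i, is_multi_fermionic (fun s => (F s)`_i) I`_i.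

Definition is_multi_fermionic_fps (k : nat)
    (F : k.-tuple padic_int -> fps (Cp T)) (I : fps (Cp T)) : Prop :=
  forall n, is_multi_fermionic (fun s => F s n) (I n).

End PadicInt.

(* Main.v *)
(* Let [D = 2 / (we^t + 1)] act on polynomials. If [E = D Q] then
   [w E(y + 1) + E(y) = 2 Q(y)], so for [H(y) = w^y E(y)] the alternating sums
   of [2 w^(c + a) Q(c + a) = H(c + a + 1) + H(c + a)] telescope: over the odd
   number [p^N] of terms the sum is [H(c) + H(c + p^N)], which tends to [2 H(c)].
   Hence each integration of [w^(c + a) Q(c + a)] gives [w^c (D Q)(c)], and the
   k-fold integral follows by induction on [k], coefficient by coefficient in
   [x] (resp. in [t]).
   Uniform differentiability rests on the [p]-adic logarithm: the quotients
   [(w^(p^n) - 1) / p^n] converge to some [L] with [|w^n - 1 - n L| <= M |n|^2]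
   for all naturals [n], and the estimate passes to exponents in [Z_p]. *)

Require Import Defs.
From HB Require Import structures.
From mathcomp Require Import all_boot all_order all_algebra.
From mathcomp Require Import all_classical all_reals.
From mathcomp Require Import ring lra.

Set Implicit Arguments.
Unset Strict Implicit.
Unset Printing Implicit Defensive.

Import Order.TTheory GRing.Theory Num.Theory.

Local Open Scope ring_scope.

(** * The action of power series on polynomials *)

Section FpsAct.
Context (K : fieldType).
Implicit Types (f g : fps K) (h : {poly K}).

Lemma derivn_size0 h i : (size h <= i)%N -> h^`(i) = 0.
Proof.
move=> le_hi; apply/polyP => j; rewrite coef_derivn coef0.
by rewrite nth_default ?mul0rn// (leq_trans le_hi)// leq_addr.
Qed.

Lemma leq_size_derivn h m : (size h^`(m) <= size h)%N.
Proof.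
elim: m => // m; apply: leq_trans; rewrite derivnS.
by have [->|/lt_size_deriv/ltnW//] := eqVneq (h^`(m)) 0; rewrite linear0.
Qed.

Lemma fps_act_wide n f h : (size h <= n)%N ->
  fps_act f h = \sum_(i < n) f i *: h^`(i).
Proof.
move=> le_hn; rewrite /fps_act (big_ord_widen _ (fun i => f i *: h^`(i)) le_hn).
rewrite [RHS](bigID (fun i : 'I_n => i < size h)%N)/= [X in _ + X]big1 ?addr0//.
by move=> i; rewrite -leqNgt => /derivn_size0 ->; rewrite scaler0.
Qed.

Lemma fps_act0r f : fps_act f 0 = 0.
Proof. by rewrite /fps_act size_poly0 big_ord0. Qed.

Lemma fps_actDl f g h : fps_act (f + g) h = fps_act f h + fps_act g h.
Proof. by rewrite -big_split; apply: eq_bigr => i _; rewrite /= scalerDl. Qed.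

Lemma fps_actCl c f h : fps_act (fpsC c * f) h = c *: fps_act f h.
Proof.
by rewrite /fps_act scaler_sumr; apply: eq_bigr => i _; rewrite fps_coefCM scalerA.
Qed.

Lemma fps_act1 h : fps_act 1 h = h.
Proof.
rewrite (fps_act_wide _ (leqnSn _)) big_ord_recl big1 ?addr0 ?scale1r//.
by move=> i _; rewrite fps_coef1 scale0r.
Qed.

Lemma fps_actZr f c h : fps_act f (c *: h) = c *: fps_act f h.
Proof.
rewrite (fps_act_wide _ (size_scale_leq c h)) /fps_act scaler_sumr.
by apply: eq_bigr => i _; rewrite derivnZ !scalerA mulrC.
Qed.

Lemma fps_act_derivn f h m : fps_act f h^`(m) = (fps_act f h)^`(m).
Proof.
rewrite (fps_act_wide _ (leq_size_derivn h m)) /fps_act linear_sum; apply: eq_bigr => i _.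
by rewrite linearZ/= /derivn -!iterD addnC.
Qed.

(** The series $(f - f(0))/t$, through which the action is computed recursively along $h'$. *)
Definition fps_behead f : fps K := Fps (fun n => f n.+1).

Lemma fps_act_behead f h :
  fps_act f h = f 0%N *: h + fps_act (fps_behead f) h^`().
Proof.
rewrite (fps_act_wide _ (leqnSn _)) big_ord_recl (@fps_act_wide (size h)).
  by congr (_ + _); apply: eq_bigr => i _; rewrite -derivSn.
by rewrite -derivn1 leq_size_derivn.
Qed.

(** Induction on a bound for the degree of [h]. With $\bar f$ for [fps_behead f], one has
    $\overline{fg} = f(0)\,\bar g + \bar f g$, and the barred series act on $h'$, of smaller
    degree. *)
Lemma fps_act_mul f g h : fps_act (f * g) h = fps_act f (fps_act g h).
Proof.
elim: (size h) {-2}h f (leqnn (size h)) => [|n IHn] {}h f.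
  by rewrite leqn0 size_poly_eq0 => /eqP ->; rewrite !fps_act0r.
move=> le_h; have le_h' : (size h^`() <= n)%N.
  have [->|/lt_size_deriv] := eqVneq h 0; first by rewrite linear0 size_poly0.
  by move=> lt_h; rewrite -ltnS (leq_trans lt_h).
rewrite fps_act_behead [RHS]fps_act_behead -[in RHS]derivn1.
rewrite -fps_act_derivn derivn1 -IHn//.
rewrite [in RHS]fps_act_behead scalerDr -addrA scalerA -fps_actCl -fps_actDl.
congr (_ *: _ + fps_act _ _); first by rewrite fps_coefM big_ord1 subn0.
apply: fpsP => m; rewrite fps_coefD fps_coefCM /= big_ord_recl subn0.
by congr (_ + _); apply: eq_bigr => i _; rewrite subSS.
Qed.

Lemma size_fps_act_leq f h : (size (fps_act f h) <= size h)%N.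
Proof.
apply: (leq_trans (size_sum _ _ _)); apply/bigmax_leqP => i _.
exact: leq_trans (size_scale_leq _ _) (leq_size_derivn _ _).
Qed.

(** Neither [f] nor its inverse raises the degree. *)
Lemma size_fps_act f h : f \is a GRing.unit -> size (fps_act f h) = size h.
Proof.
move=> Uf; apply/eqP; rewrite eqn_leq size_fps_act_leq/=.
by rewrite -{1}[h]fps_act1 -(mulVr Uf) fps_act_mul size_fps_act_leq.
Qed.

(** Turns a pairing with a product of series into a composition of operators. *)
Lemma fps_pair_act f h : fps_pair f h = (fps_act f h).[0].
Proof.
rewrite /fps_pair /fps_act horner_sum; apply: eq_bigr => i _.
rewrite hornerZ horner_coef0 coef_derivn addn0 ffactnn -[h`_i *+ _]mulr_natr.
by rewrite [RHS]mulrCA [f i * _]mulrC.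
Qed.

Lemma fps_pairXn f n : fps_pair f 'X^n = n`!%:R * f n.
Proof.
rewrite /fps_pair size_polyXn big_ord_recr big1 /= => [|i _].
  by rewrite add0r coefXn eqxx mul1r.
by rewrite coefXn ltn_eqF// mul0r.
Qed.

Lemma fps_act_t m h : fps_act (Fps (fun n => (n == 1%N)%:R) ^+ m) h = h^`(m).
Proof.
elim: m h => [|m IHm] h; first by rewrite expr0 fps_act1.
rewrite exprSr fps_act_mul derivSn -IHm; congr fps_act.
rewrite fps_act_behead scale0r add0r -[RHS]fps_act1; congr fps_act.
by apply: fpsP => n; rewrite fps_coef1 /= eqSS.
Qed.

(** Since $f(t)$ commutes with $h \mapsto h^{(i)}/i!$, a coefficient in $x$ is a value at $0$; this
    reduces the integral of a polynomial to scalar integrals. *)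
Lemma coef_fps_act f h i : (fps_act f h)`_i = (fps_act f h^`N(i)).[0] :> K.
Proof.
rewrite [in RHS](@fps_act_wide (size h)).
  rewrite coef_sum horner_sum; apply: eq_bigr => j _.
  rewrite coefZ hornerZ horner_coef0 !coef_derivn coef_nderivn !addn0.
  rewrite [(i + j)%N]addnC -mulrnA ffactnn -bin_ffact.
  by rewrite -[in RHS]bin_sub ?leq_addl// addnK.
apply/leq_sizeP => j le_j; rewrite coef_nderivn nth_default ?mul0rn//.
by rewrite (leq_trans le_j)// leq_addl.
Qed.

Lemma coef_comp_polyCaddX c h i : (h \Po (c%:P + 'X))`_i = h^`N(i).[c].
Proof.
elim/poly_ind: h i => [|h d IHh] i; first by rewrite comp_poly0 linear0 horner0 coef0.
rewrite comp_poly_MXaddC mulrDr !coefD coefC coefMC coefMX !IHh.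
case: i => [|i]; first by rewrite !nderivn0 !hornerE mulrC.
by rewrite nderivnMXaddC !hornerE addrC.
Qed.

End FpsAct.

(** * Weighted Euler polynomials and their Sheffer property *)

Lemma fps_unitE (A : comUnitRingType) (f : fps A) :
  (f \is a GRing.unit) = (f 0%N \is a GRing.unit).
Proof. by []. Qed.

(** Views $K[[t]]$ inside $K[x][[t]]$, the ring in which [weighted_euler] is computed. *)
Definition fps_polyC (A : comNzRingType) (f : fps A) : fps {poly A} :=
  Fps (fun n => (f n)%:P).

Lemma fps_polyCM (A : comNzRingType) (f g : fps A) :
  fps_polyC (f * g) = fps_polyC f * fps_polyC g.
Proof.
apply: fpsP => n; rewrite fps_coefM /= rmorph_sum.
by apply: eq_bigr => i _; rewrite rmorphM.
Qed.

Lemma fps_polyC1 (A : comNzRingType) : fps_polyC (1 : fps A) = 1.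
Proof. by apply: fpsP => -[|n] /=. Qed.

Lemma fps_polyCX (A : comNzRingType) (f : fps A) k :
  fps_polyC (f ^+ k) = fps_polyC f ^+ k.
Proof.
by elim: k => [|k IHk]; rewrite ?expr0 ?fps_polyC1// !exprS fps_polyCM IHk.
Qed.

Section WeightedEuler.
Context (K : fieldType) (charK : [pchar K] =i pred0).
Implicit Types (h : {poly K}) (w y : K).

Let natf_neq0 n : (n.+1)%:R != 0 :> K.
Proof. by rewrite ((pcharf0P _).1 charK). Qed.

Let fact_neq0 n : n`!%:R != 0 :> K.
Proof. by rewrite ((pcharf0P _).1 charK) -lt0n fact_gt0. Qed.

(** Taylor's formula: $e^t$ acts as translation by $1$. *)
Lemma horner_fps_act_wexp w h y :
  (fps_act (fps_wexp w) h).[y] = w * h.[y + 1].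
Proof.
rewrite fps_actCl hornerZ; congr (_ * _).
rewrite (nderiv_taylor _ (mulrC y 1)) horner_sum; apply: eq_bigr => i _.
by rewrite hornerZ nderivn_def /= hornerMn !expr1n mulr1 mul1r -[_.[y] *+ _]mulr_natl mulKf.
Qed.

Lemma fps_wexpD1_coef0 w : (fps_wexp w + 1) 0%N = w + 1.
Proof.
by rewrite fps_coefD fps_coefCM fps_coef1 /= expr0 fact0 divr1 mulr1.
Qed.

Lemma fps_wexpD1_unit w : w + 1 != 0 -> fps_wexp w + 1 \is a GRing.unit.
Proof. by move=> w1; rewrite fps_unitE fps_wexpD1_coef0 unitfE. Qed.

Lemma fps2_unit : (2 : fps K) \is a GRing.unit.
Proof. by rewrite fps_unitE unitfE; exact: (natf_neq0 1). Qed.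

Lemma horner_fps_act_euler w h y : w + 1 != 0 ->
  let E := fps_act (2 / (fps_wexp w + 1)) h in
  w * E.[y + 1] + E.[y] = 2 * h.[y].
Proof.
move=> w1 E; rewrite -horner_fps_act_wexp -{2}[E]fps_act1 -hornerD -fps_actDl.
rewrite -fps_act_mul mulrC divrK ?fps_wexpD1_unit//.
have -> : (2 : fps K) = fpsC 2 * 1.
  apply: fpsP => n; rewrite fps_coefCM fps_coefD fps_coef1.
  by rewrite -mulr2n mulr_natl.
by rewrite fps_actCl fps_act1 hornerZ.
Qed.

Lemma fps_polyC_wexp w : fps_polyC (fps_wexp w + 1) = fps_wexp w%:P + 1.
Proof.
apply: fpsP => n; rewrite /= !big_ord_recl !big1; last 2 first.
- by move=> i _; rewrite mul0r.
- by move=> i _; rewrite mul0r.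
rewrite /= !addr0 !expr1n !mul1r subn0 polyCD polyCM -polyCV polyC_natr.
by case: n.
Qed.

(** The coefficient of $t^n$ in $f(t)e^{xt}$ is $\sum_i f_i x^{n-i}/(n-i)!$, and
    $n!\,x^{n-i}/(n-i)!$ is the $i$-th derivative of $x^n$. *)
Lemma weighted_eulerE w k n : w + 1 != 0 ->
  weighted_euler w k n = fps_act ((2 / (fps_wexp w + 1)) ^+ k) 'X^n.
Proof.
move=> w1; set f := 2 / _.
have -> : weighted_euler w k n = n`!%:R * (fps_polyC (f ^+ k) * fps_exp 'X) n.
  rewrite /weighted_euler fps_polyCX.
  suff -> : fps_polyC f = 2 / (fps_wexp w%:P + 1) by [].
  (* Inversion in [fps {poly K}] is genuine only for an invertible constant term; here that term is
     the nonzero constant $w+1$. *)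
  have U : fps_wexp w%:P + 1 \is a GRing.unit.
    rewrite -fps_polyC_wexp fps_unitE -[fps_polyC _ _]/(polyC _) fps_wexpD1_coef0.
    by rewrite poly_unitE size_polyC w1 coefC unitfE.
  apply: (mulIr U); rewrite divrK// -fps_polyC_wexp -fps_polyCM divrK//.
    by apply: fpsP => -[|i]; rewrite /= ?addr0 ?polyCD.
  exact: fps_wexpD1_unit.
rewrite fps_coefM mulr_sumr (@fps_act_wide _ n.+1) ?size_polyXn//.
apply: eq_bigr => -[i /=]; rewrite ltnS => le_in _.
rewrite derivnXn -mul_polyC mulrCA; congr (_ * _).
rewrite -!polyC_natr polyCV mulrCA -polyCM mulrC mul_polyC -scaler_nat.
by rewrite -(ffact_fact le_in) natrM mulfK.
Qed.

(** The first series of the pair is inverse to the one producing the polynomials, so the pairing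
    collapses to the $m$-th derivative of $x^n$ at $0$. *)
Lemma weighted_euler_sheffer w k : w + 1 != 0 ->
  is_sheffer (((fps_wexp w + 1) / 2) ^+ k) (Fps (fun n => (n == 1%N)%:R))
    (weighted_euler w k).
Proof.
move=> w1; set g := _ ^+ k; set f := (2 / (fps_wexp w + 1)) ^+ k.
have U := fps_wexpD1_unit w1; have U2 := fps2_unit.
have gf : g * f = 1.
  by rewrite -exprMn mulrA divrK// divrr// expr1n.
have [Ug Uf] : g \is a GRing.unit /\ f \is a GRing.unit.
  by split; rewrite unitrX// unitrM unitrV U U2.
split; first by split; [rewrite -unitfE -fps_unitE | | exact: oner_neq0].
split=> [n|n m]; rewrite weighted_eulerE//.
  by rewrite size_fps_act// size_polyXn.
rewrite fps_pair_act -fps_act_mul mulrAC gf mul1r fps_act_t derivnXn.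
rewrite hornerMn hornerXn; case: eqVneq => [->|ne_nm].
  by rewrite subnn ffactnn.
case: (ltngtP n m) ne_nm => // lt_nm _; first by rewrite ffact_small.
by rewrite expr0n subn_eq0 leqNgt lt_nm mul0rn.
Qed.

End WeightedEuler.

(** * Powers in a complete p-adic field *)

Section Ultrametric.
Context (R : realType) (K : fieldType) (a : absval R K).
Context (a0 : a 0 = 0).

Lemma absvN x : a (- x) = a x.
Proof.
have N1 : a (-1) = 1.
  have := absv_mul a (-1) (-1); rewrite mulrNN mulr1 absv_one.
  move/esym/eqP; rewrite -expr2 sqrf_eq1 => /orP[/eqP//|/eqP eN1].
  by have := absv_ge0 a (-1); rewrite eN1 lerNr oppr0 ler10.
by rewrite -mulN1r absv_mul N1 mul1r.
Qed.

Lemma absv_subC x y : a (x - y) = a (y - x).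
Proof. by rewrite -absvN opprB. Qed.

Lemma absvX x n : a (x ^+ n) = a x ^+ n.
Proof.
by elim: n => [|n IHn]; rewrite ?expr0 ?absv_one// !exprS absv_mul IHn.
Qed.

Lemma absv_gt0 x : x != 0 -> 0 < a x.
Proof.
by rewrite lt_neqAle absv_ge0 andbT => /eqP nx; apply/eqP => /esym/absv_eq0.
Qed.

Lemma absvV x : a x^-1 = (a x)^-1.
Proof.
have [->|nx] := eqVneq x 0; first by rewrite invr0 a0 invr0.
apply: (mulfI (lt0r_neq0 (absv_gt0 nx))).
by rewrite -absv_mul !divff ?absv_one// lt0r_neq0// absv_gt0.
Qed.

Lemma absv_add_le M x y : a x <= M -> a y <= M -> a (x + y) <= M.
Proof.
by move=> xM yM; apply: le_trans (absv_ultra a x y) _; rewrite ge_max xM.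
Qed.

Lemma absv_add_lt M x y : a x < M -> a y < M -> a (x + y) < M.
Proof.
by move=> xM yM; apply: le_lt_trans (absv_ultra a x y) _; rewrite gt_max xM.
Qed.

Lemma absv_sub_le M x y : a x <= M -> a y <= M -> a (x - y) <= M.
Proof. by move=> xM yM; apply: absv_add_le; rewrite ?absvN. Qed.

Lemma absv_sum_le (I : Type) (r : seq I) (P : pred I) (F : I -> K) M :
  0 <= M -> (forall i, P i -> a (F i) <= M) -> a (\sum_(i <- r | P i) F i) <= M.
Proof.
move=> M0 FM; elim/big_rec: _ => [|i x Pi xM]; first by rewrite a0.
by apply: absv_add_le; rewrite ?FM.
Qed.

Lemma absv_nat_le1 n : a n%:R <= 1.
Proof.
elim: n => [|n IHn]; first by rewrite a0.
by rewrite -natr1 absv_add_le ?absv_one.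
Qed.

(** The isosceles principle; it transfers an absolute value between a point and its
    approximations. *)
Lemma absv_eq_of_close x y : a (x - y) < a x -> a y = a x.
Proof.
move=> xy; apply/le_anti/andP; split.
  by rewrite -(subKr x y) absv_sub_le// ltW.
rewrite leNgt; apply/negP => yx.
by have := absv_add_lt xy yx; rewrite subrK ltxx.
Qed.

Lemma absv_eq1 w : a (w - 1) < 1 -> a w = 1.
Proof.
by rewrite absv_subC -(absv_one a) => /absv_eq_of_close ->.
Qed.

Lemma absv_subX w z n : a w <= 1 -> a z <= 1 -> a (w ^+ n - z ^+ n) <= a (w - z).
Proof.
move=> w1 z1; rewrite subrXX absv_mul ler_piMr ?absv_ge0// absv_sum_le// => i _.
by rewrite absv_mul !absvX mulr_ile1 ?exprn_ge0 ?absv_ge0 ?exprn_ile1 ?absv_ge0.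
Qed.

Lemma absv_eq_of_lt x y : (forall e, 0 < e -> a (x - y) < e) -> x = y.
Proof.
move=> H; apply/eqP; rewrite -subr_eq0; apply/eqP/(absv_eq0 (a := a)).
apply/eqP; rewrite eq_le absv_ge0 andbT leNgt; apply/negP => /H.
by rewrite ltxx.
Qed.

End Ultrametric.

Lemma exists_pow_lt (R : realType) (r e : R) :
  0 <= r < 1 -> 0 < e -> exists n, r ^+ n < e.
Proof.
move=> /andP[r0 r1] e0; have [->|nr] := eqVneq r 0.
  by exists 1%N; rewrite expr1.
have {nr}r0 : 0 < r by rewrite lt_neqAle eq_sym nr.
pose d := r^-1 - 1; have d0 : 0 < d by rewrite subr_gt0 invf_gt1.
(* Bernoulli's inequality for $1/r = 1 + d$. *)
have bern n : 1 + n%:R * d <= r^-1 ^+ n.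
  elim: n => [|n IHn]; first by rewrite mul0r addr0.
  have rd : r^-1 = d + 1 by rewrite subrK.
  have d1 : 0 <= d + 1 by rewrite addr_ge0 ?ltW.
  rewrite exprS {1}rd; apply: le_trans (ler_wpM2l d1 IHn).
  have : 0 <= n%:R * (d * d) by rewrite !mulr_ge0 ?ler0n ?ltW.
  by rewrite -natr1; lra.
have [n ne] : exists n, (e * d)^-1 < n%:R :> R.
  exists (Num.Def.archi_bound (e * d)^-1); apply: archi_boundP.
  by rewrite invr_ge0 mulr_ge0 ?ltW.
exists n; rewrite -[r]invrK exprVn invf_plt ?posrE ?exprn_gt0 ?invr_gt0//.
apply: lt_le_trans (bern n); rewrite -(ltr_pM2r d0) invfM mulfVK ?lt0r_neq0// in ne.
by apply: lt_trans ne _; rewrite ltrDr ltr01.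
Qed.

(** * Linear approximation of $n \mapsto w^n$ by the $p$-adic logarithm *)

Section PadicLog.
Context (R : realType) (p : nat) (p_prime : prime p).
Context (K : fieldType) (a : absval R K).
Context (aE : forall n : nat, a n%:R = padic_abs R p n%:R).
Context (a_complete : forall u : nat -> K,
    (forall e : R, 0 < e -> exists N, forall m n,
       (N <= m)%N -> (N <= n)%N -> a (u m - u n) < e) ->
    exists l, forall e : R, 0 < e -> exists N, forall n,
      (N <= n)%N -> a (u n - l) < e).

Let q : R := p%:R^-1.

Let q_gt0 : 0 < q.
Proof. by rewrite invr_gt0 ltr0n prime_gt0. Qed.

Let q_lt1 : q < 1.
Proof. by rewrite invf_lt1 ?ltr1n ?prime_gt1// ltr0n prime_gt0. Qed.

(** The constant function $1$ satisfies the axioms of [absval], so $|0| = 0$ has to come from the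
    values that [aE] prescribes on the naturals. *)
Lemma padic_absv0 : a 0 = 0.
Proof. by rewrite -[0 in LHS]/(0%:R) aE /padic_abs eqxx. Qed.

Let a0 := padic_absv0.

Lemma padic_absv_nat n : (0 < n)%N -> a n%:R = q ^+ logn p n.
Proof.
move=> n0; rewrite aE /padic_abs pnatr_eq0 -[n == 0%N]negbK -lt0n n0 /=.
rewrite -[n%:R]/(n%:Z%:~R) denq_int numq_int /= logn1 sub0r.
by rewrite exprVn -exprnN.
Qed.

Lemma padic_absv_p : a p%:R = q.
Proof. by rewrite padic_absv_nat ?prime_gt0// logn_prime// eqxx. Qed.

Lemma padic_nat_neq0 n : (0 < n)%N -> n%:R != 0 :> K.
Proof.
move=> n0; apply/eqP => /(congr1 a)/eqP.
by rewrite a0 padic_absv_nat// expf_eq0 gt_eqF ?andbF.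
Qed.

Lemma padic_pchar0 : [pchar K] =i pred0.
Proof.
apply/pcharf0P => -[|n]; first by rewrite mulr0n !eqxx.
by rewrite (negPf (padic_nat_neq0 (ltn0Sn n))).
Qed.

(** The inverse is $p^{v_p(n)}$, a divisor of $n$. *)
Lemma padic_absv_natV_le n : (0 < n)%N -> (a n%:R)^-1 <= n%:R.
Proof.
move=> n0; rewrite padic_absv_nat// -exprVn invrK -natrX ler_nat.
by rewrite dvdn_leq// pfactor_dvdnn.
Qed.

Lemma padic_absv_nat_eq1 n : coprime p n -> a n%:R = 1.
Proof.
case: n => [|n] co; last by rewrite padic_absv_nat// logn_coprime.
by have := prime_gt1 p_prime; rewrite (eqP (_ : p == 1%N))// -[p]gcdn0.
Qed.

Lemma padic_dvdn_absv N n : (a n%:R <= q ^+ N) = (p ^ N %| n)%N.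
Proof.
case: n => [|n]; first by rewrite a0 dvdn0 exprn_ge0// ltW.
by rewrite padic_absv_nat// pfactor_dvdn// ler_iXn2l.
Qed.

(* In the binomial expansion ['C(m, i) / m = 'C(m - 1, i - 1) / i] and [|1 / i| <= i], *)
(* which the factor [|v - 1|^i] absorbs. *)
Lemma absv_pow_sub_quad v m : a (v - 1) <= 2^-1 ->
  a (v ^+ m - 1 - m%:R * (v - 1)) <= 2 * a m%:R * a (v - 1) ^+ 2.
Proof.
set u := v - 1 => u12; have u0 := absv_ge0 a u.
case: m => [|m]; first by rewrite expr0 subrr mul0r subr0 a0 mulr0 mul0r.
have B0 : 0 <= 2 * a m.+1%:R * a u ^+ 2 by rewrite !mulr_ge0 ?exprn_ge0 ?absv_ge0.
have -> : v ^+ m.+1 - 1 - m.+1%:R * u =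
    \sum_(i < m) u ^+ i.+2 *+ 'C(m.+1, i.+2).
  have -> : v = 1 + u by rewrite addrC subrK.
  rewrite exprDn 2!big_ord_recl.
  rewrite /= !expr1n bin0.
  rewrite -[1 * u ^+ bump 0 0 *+ _]/(1 * u ^+ 1 *+ 'C(m.+1, 1)) bin1 !mul1r mulr_natl.
  rewrite [1 + _]addrC addrK addrAC subrr add0r.
  by apply: eq_bigr => i _; rewrite expr1n mul1r.
apply: absv_sum_le => // i _.
have -> : a (u ^+ i.+2 *+ 'C(m.+1, i.+2)) = a 'C(m.+1, i.+2)%:R * a u ^+ i.+2.
  by rewrite -mulr_natl absv_mul absvX.
have Cle : a 'C(m.+1, i.+2)%:R <= a m.+1%:R * i.+2%:R.
  have := congr1 (fun n : nat => a n%:R) (mul_bin_diag m.+1 i.+1).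
  rewrite !natrM !absv_mul /= => /(congr1 ( *%R (a i.+2%:R)^-1)).
  rewrite mulKf => [<-|]; last first.
    by rewrite lt0r_neq0// absv_gt0// padic_nat_neq0.
  rewrite mulrC -mulrA ler_wpM2l ?absv_ge0//.
  by rewrite -[leRHS]mul1r ler_pM ?invr_ge0 ?absv_ge0 ?absv_nat_le1 ?padic_absv_natV_le.
apply: (@le_trans _ _ (a m.+1%:R * i.+2%:R * a u ^+ i.+2)).
  by rewrite ler_wpM2r ?exprn_ge0.
rewrite -addn2 exprD mulrA ler_wpM2r ?exprn_ge0// addn2.
rewrite [2 * _]mulrC -mulrA ler_wpM2l ?absv_ge0//.
(* The factor $i+2 \le 2^{i+1}$ meets $|u|^i \le 2^{-i}$, which leaves the constant $2$. *)
apply: (@le_trans _ _ (2 ^+ i.+1 * 2^-1 ^+ i)).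
  apply: ler_pM; rewrite ?exprn_ge0// ?lerXn2r ?nnegrE ?invr_ge0//.
  by rewrite -natrX ler_nat ltn_expl.
by rewrite exprS -mulrA -exprMn divff ?pnatr_eq0// expr1n mulr1.
Qed.

(** Since $v^p - 1 = (v-1)\sum_{j<p} v^j$ and the sum equals $p + \sum_{j<p}(v^j-1)$, each $p$-th
    power gains a factor [r], which bounds both $|p|$ and $|v-1|$. *)
Lemma absv_expp_sub1_le w n : a (w - 1) < 1 ->
  a (w ^+ (p ^ n) - 1) <= Num.max q (a (w - 1)) ^+ n.+1.
Proof.
move=> w1; set r := Num.max _ _.
have r0 : 0 <= r by rewrite le_max ltW.
have r1 : r < 1 by rewrite gt_max q_lt1.
elim: n => [|n IHn]; first by rewrite expn0 !expr1 le_max lexx orbT.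
rewrite expnSr exprM; set v := w ^+ (p ^ n) in IHn *.
have vr : a (v - 1) <= r.
  by apply: le_trans IHn _; rewrite exprS ler_piMr// exprn_ile1// ltW.
have v1 : a v <= 1 by rewrite (absv_eq1 (le_lt_trans vr r1)).
rewrite -[X in a (_ - X)](expr1n _ p) subrXX absv_mul exprSr.
rewrite ler_pM ?absv_ge0//.
have -> : \sum_(i < p) v ^+ (p.-1 - i) * 1 ^+ i =
    \sum_(i < p) (v ^+ (p.-1 - i) - 1 ^+ (p.-1 - i)) + p%:R.
  rewrite sumrB addrAC -addrA.
  rewrite [X in _ + (_ - X)](eq_bigr (fun=> 1)) => [|i _]; last by rewrite expr1n.
  rewrite sumr_const card_ord subrr addr0.
  by apply: eq_bigr => i _; rewrite expr1n mulr1.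
apply: absv_add_le; last by rewrite padic_absv_p le_max lexx.
by apply: absv_sum_le => // i _; apply: le_trans vr; rewrite absv_subX ?absv_one.
Qed.

(** The slope is the $p$-adic logarithm of [v]. Starting within $1/2$ of $1$ makes every $v^{p^n}$
    meet the hypothesis of the quadratic estimate. *)
Lemma absv_pow_linear_of_small v : a (v - 1) <= 2^-1 ->
  exists l : K, forall m : nat,
    a (v ^+ m - 1 - m%:R * l) <= 2 * a (v - 1) ^+ 2 * a m%:R ^+ 2.
Proof.
move=> u12; set B := 2 * _; have u0 := absv_ge0 a (v - 1).
have B0 : 0 <= B by rewrite mulr_ge0 ?exprn_ge0.
have qn0 n : 0 <= q ^+ n by rewrite exprn_ge0// ltW.
have qX n : a (p ^ n)%:R = q ^+ n by rewrite natrX absvX padic_absv_p.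
(* The quadratic error does not exceed the linear term, because $2|v-1|^2 \le |v-1|$. *)
have vX n : a (v ^+ (p ^ n) - 1) <= q ^+ n * a (v - 1).
  rewrite -[X in a X](subrK ((p ^ n)%:R * (v - 1))).
  apply: absv_add_le; last by rewrite absv_mul qX.
  apply: le_trans (absv_pow_sub_quad _ u12) _; rewrite qX.
  rewrite mulrAC mulrC ler_wpM2l ?qn0// expr2 mulrA ler_piMl//.
  by move: u12; lra.
have vX12 n : a (v ^+ (p ^ n) - 1) <= 2^-1.
  by apply: le_trans (vX n) _; apply: le_trans _ u12; rewrite ler_piMl// exprn_ile1// ltW.
have pn0 n : (p ^ n)%:R != 0 :> K by rewrite padic_nat_neq0// expn_gt0 prime_gt0.
pose l n := (v ^+ (p ^ n) - 1) / (p ^ n)%:R.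
have lE n m : a (v ^+ (p ^ n * m) - 1 - (p ^ n * m)%:R * l n)
    <= B * a m%:R * q ^+ n ^+ 2.
  rewrite exprM natrM mulrAC /l mulrC [_%:R * (_ / _)]mulrC divfK//.
  apply: le_trans (absv_pow_sub_quad _ (vX12 n)) _.
  rewrite [leRHS](_ : _ = 2 * a m%:R * (q ^+ n * a (v - 1)) ^+ 2).
    rewrite ler_wpM2l ?mulr_ge0 ?absv_ge0//.
    by rewrite lerXn2r ?nnegrE ?mulr_ge0 ?absv_ge0 ?qn0 ?vX.
  by rewrite /B; ring.
(* This is [lE] with $m = p^{k-n}$, divided by $|p^k|$: the bound $B q^{k-n} q^{2n}$ becomes $B
   q^n$. *)
have l_sub n k : (n <= k)%N -> a (l k - l n) <= B * q ^+ n.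
  move=> le_nk; rewrite -(ler_pM2l (exprn_gt0 k q_gt0)) -{1}(qX k) -absv_mul.
  have := lE n (p ^ (k - n))%N; rewrite -expnD subnKC// mulrBr /l [in X in _ -> X]mulrC.
  rewrite divfK// qX; move/le_trans; apply.
  by rewrite -(subnK le_nk) exprD subnK// le_eqVlt; apply/orP; left; apply/eqP; ring.
have [L HL] : exists L, forall e : R, 0 < e -> exists N, forall n,
    (N <= n)%N -> a (l n - L) < e.
  apply: a_complete => e e0.
  have [N qN] := exists_pow_lt (introT andP (conj (ltW q_gt0) q_lt1))
    (divr_gt0 e0 (ltr_wpDl B0 ltr01)).
  have BN : B * q ^+ N < e.
    rewrite ltr_pdivlMr ?ltr_wpDl// in qN; apply: le_lt_trans qN.
    by rewrite mulrC ler_wpM2l ?qn0// lerDl.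
  exists N => m n Nm Nn; apply: le_lt_trans BN.
  rewrite -(subrK (l N) (l m)) -addrA; apply: absv_add_le; first exact: l_sub.
  by rewrite absv_subC l_sub.
have L_sub n : a (L - l n) <= B * q ^+ n.
  apply/ler_addgt0Pr => e e0; have [N NL] := HL e e0.
  rewrite -(subrK (l (maxn n N)) L) -addrA; apply: absv_add_le.
    rewrite absv_subC; apply: le_trans (ltW (NL _ (leq_maxr _ _))) _.
    by rewrite lerDr mulr_ge0 ?qn0.
  by apply: le_trans (l_sub _ _ (leq_maxl _ _)) _; rewrite lerDl ltW.
exists L => m; have [->|m0] := posnP m.
  by rewrite expr0 subrr mul0r subr0 a0 mulr_ge0 ?exprn_ge0.
(* Write $m = p^n m'$ with $m'$ prime to $p$, so that $|m| = q^n$. Then [lE] bounds the error for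
   the slope [l n], and replacing [l n] by [L] costs at most $q^n \cdot B q^n$. *)
rewrite (padic_absv_nat m0); have [m' co mE] := pfactor_coprime p_prime m0.
set n := logn p m in mE *.
rewrite (_ : _ - m%:R * L = v ^+ m - 1 - m%:R * l n - m%:R * (L - l n)); last by ring.
apply: absv_sub_le.
  by have := lE n m'; rewrite mulnC -mE padic_absv_nat_eq1// mulr1.
by rewrite absv_mul padic_absv_nat// expr2 mulrCA ler_wpM2l.
Qed.

(** Some $w^{p^N}$ lies within $1/2$ of $1$, and its slope divided by $p^N$ serves for multiples of
    $p^N$. Other exponents satisfy $|n| > p^{-N}$, so a constant bound is enough. *)
Lemma absv_pow_linear w : a (w - 1) < 1 ->
  exists L, exists2 M, 0 <= M &
    forall n : nat, a (w ^+ n - 1 - n%:R * L) <= M * a n%:R ^+ 2.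
Proof.
move=> w1; have [N vN] : exists N, a (w ^+ (p ^ N) - 1) <= 2^-1.
  have r01 : 0 <= Num.max q (a (w - 1)) < 1 by rewrite le_max ltW// gt_max q_lt1.
  have half_gt0 : 0 < 2^-1 :> R by rewrite invr_gt0.
  have [N rN] := exists_pow_lt r01 half_gt0; exists N.
  apply: le_trans (absv_expp_sub1_le _ w1) _; apply: le_trans (ltW rN).
  case/andP: r01 => r0 r1.
  by rewrite exprS ler_piMl ?exprn_ge0// ltW.
have [l Hl] := absv_pow_linear_of_small vN; set B := 2 * _ in Hl.
have pN0 : (p ^ N)%:R != 0 :> K by rewrite padic_nat_neq0// expn_gt0 prime_gt0.
have qN : a (p ^ N)%:R = q ^+ N by rewrite natrX absvX padic_absv_p.
have qN0 : 0 < q ^+ N by rewrite exprn_gt0.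
pose L := l / (p ^ N)%:R; pose C := Num.max B (Num.max 1 (a L)).
have C0 : 0 <= C by rewrite !le_max ler01 orbT.
(* Division by $q^{2N}$ serves both cases: $|n/p^N|^2 = |n|^2/q^{2N}$ for multiples, and $1 \le
   |n|^2/q^{2N}$ for the others, where [C] bounds $|w^n|$, $1$ and $|nL|$. *)
exists L, (C / q ^+ N ^+ 2); first by rewrite divr_ge0// exprn_ge0// ltW.
move=> n; have [/dvdnP[m ->]|ndv] := boolP (p ^ N %| n)%N.
  rewrite mulnC exprM natrM mulrAC [_ * L]mulrC divfK// [l * _]mulrC.
  apply: le_trans (Hl m) _; rewrite absv_mul qN.
  rewrite exprMn [leRHS]mulrA divfK ?expf_neq0 ?lt0r_neq0//.
  by rewrite ler_wpM2r ?exprn_ge0 ?absv_ge0// le_max lexx.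
have an : q ^+ N < a n%:R by rewrite ltNge padic_dvdn_absv.
apply: (@le_trans _ _ C); last first.
  rewrite -mulrA ler_peMr// mulrC ler_pdivlMr ?exprn_gt0// mul1r.
  by rewrite lerXn2r ?nnegrE ?absv_ge0// ltW.
have w_1 := absv_eq1 w1.
apply: absv_sub_le; first apply: absv_sub_le.
- by rewrite absvX w_1 expr1n !le_max lexx !orbT.
- by rewrite absv_one !le_max lexx !orbT.
- by rewrite absv_mul !le_max ler_piMl ?absv_ge0 ?absv_nat_le1 ?orbT.
Qed.

(** One has $w^m - w^n = w^n(w^{m-n}-1)$ with $|w^n| = 1$, and $|m-n|^2 \le |m-n|$ absorbs the
    quadratic remainder. *)
Lemma absv_pow_lipschitz w : a (w - 1) < 1 -> exists2 M, 0 <= M &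
  forall m n : nat, a (w ^+ m - w ^+ n) <= M * a (m%:R - n%:R).
Proof.
move=> w1; have [L [M M0 HM]] := absv_pow_linear w1.
have C0 : 0 <= Num.max M (a L) by rewrite le_max M0.
exists (Num.max M (a L)) => // m n.
wlog le_nm : m n / (n <= m)%N.
  move=> H; have [/H//|/ltnW/H] := leqP n m.
  by rewrite [a (w ^+ n - _)]absv_subC [a (n%:R - _)]absv_subC.
rewrite -(subnK le_nm) exprD natrD addrK -[X in a (_ - X)]mul1r -mulrBl.
rewrite absv_mul absvX (absv_eq1 w1) expr1n mulr1; set z := (m - n)%N.
have z0 := absv_ge0 a z%:R; have z1 : a z%:R <= 1 by rewrite absv_nat_le1.
rewrite -[X in a X](subrK (z%:R * L)); apply: absv_add_le.
  apply: le_trans (HM z) _; apply: ler_pM; rewrite ?exprn_ge0 ?le_max ?lexx//.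
  by rewrite expr2 ler_piMl.
by rewrite absv_mul mulrC ler_wpM2r// le_max lexx orbT.
Qed.

End PadicLog.

(** * Integration over Z_p *)

Section Tower.
Context (R : realType) (p : nat) (p_prime : prime p) (T : padic_tower R p).
Local Notation Zp := (padic_int T).
Local Notation C := (Cp T).
Local Notation iota := (@padic_int_in R p T).

Let q : R := p%:R^-1.

Let q_gt0 : 0 < q.
Proof. by rewrite invr_gt0 ltr0n prime_gt0. Qed.

Let q01 : 0 <= q < 1.
Proof. by rewrite ltW// invf_lt1 ?ltr1n ?prime_gt1// ltr0n prime_gt0. Qed.

Lemma Qp_abs_nat n : Qp_abs T n%:R = padic_abs R p n%:R.
Proof. by rewrite -(rmorph_nat (Qp_in T)) (completion_isom (Qp_completion T)). Qed.

Lemma Cp_abs_Qp x : Cp_abs T (Cp_in T (Qpbar_in T x)) = Qp_abs T x.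
Proof. by rewrite (completion_isom (Cp_completion T)) Qpbar_isom. Qed.

Lemma Cp_abs_nat n : Cp_abs T n%:R = padic_abs R p n%:R.
Proof.
by rewrite -!(rmorph_nat (Cp_in T)) -(rmorph_nat (Qpbar_in T)) Cp_abs_Qp Qp_abs_nat.
Qed.

Let Qp_abs0 := padic_absv0 Qp_abs_nat.
Let Cp_abs0 := padic_absv0 Cp_abs_nat.
Let Cp_complete := completion_complete (Cp_completion T).

Lemma Cp_abs_iota a : Cp_abs T (iota a) = padic_int_abs a.
Proof. exact: Cp_abs_Qp. Qed.

Fact padic_int_in_zmod_morphism : zmod_morphism iota.
Proof. by move=> a b; rewrite /padic_int_in !rmorphB. Qed.

Fact padic_int_in_monoid_morphism : monoid_morphism iota.
Proof.
split=> [|a b]; first by rewrite /padic_int_in !rmorph1.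
by rewrite /padic_int_in !rmorphM.
Qed.

HB.instance Definition _ :=
  GRing.isZmodMorphism.Build Zp C iota padic_int_in_zmod_morphism.
HB.instance Definition _ :=
  GRing.isMonoidMorphism.Build Zp C iota padic_int_in_monoid_morphism.

Lemma Cp_abs_iota_le1 (a : Zp) : Cp_abs T (iota a) <= 1.
Proof. by rewrite Cp_abs_iota; apply: (valP a). Qed.

Lemma Qp_abs_int (z : int) : Qp_abs T z%:~R = Qp_abs T `|z|%:R.
Proof. by case: z => n //; rewrite NegzE rmorphN/= absvN// abszN. Qed.

Lemma Qp_abs_int_le1 (z : int) : Qp_abs T z%:~R <= 1.
Proof. by rewrite Qp_abs_int absv_nat_le1. Qed.

(** A rational at distance below $1$ from [a] is $p$-integral, so its denominator is invertible
    modulo every $p^N$, and its residue modulo a high $p^N$ is the natural sought. *)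
Lemma padic_int_nat_dense (a : Zp) (e : R) : 0 < e ->
  exists n : nat, Cp_abs T (n%:R - iota a) < e.
Proof.
move=> e0; have m0 : 0 < Num.min e 1 by rewrite lt_min e0 ltr01.
have [x] := completion_dense (Qp_completion T) (padic_int_val a) m0.
rewrite lt_min => /andP[xe x1]; set y := Qp_in T x in xe x1.
have y1 : Qp_abs T y <= 1.
  rewrite -(subKr (padic_int_val a) y).
  by apply: absv_sub_le; [apply: (valP a) | apply: ltW].
pose d := `|denq x|%N.
have yd : y * d%:R = (numq x)%:~R.
  rewrite -(rmorph_int (Qp_in T)) numqE rmorphM; congr (_ * _).
  by rewrite -[in RHS]absz_denq rmorph_int.
(* If [p] divided [d], then $|y| \le 1$ would make it divide the numerator $yd$ too, against
   coprimality. *)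
have co_d : coprime p d.
  rewrite prime_coprime//; apply/negP => p_d.
  have : (p %| `|numq x|)%N.
    rewrite -[p]expn1 -(padic_dvdn_absv p_prime Qp_abs_nat) -Qp_abs_int -yd absv_mul.
    rewrite -[p in (p %| d)%N]expn1 -(padic_dvdn_absv p_prime Qp_abs_nat) in p_d.
    by rewrite -[leRHS]mul1r ler_pM ?absv_ge0.
  move=> p_n; have := coprime_num_den x; rewrite /coprime => /eqP g1.
  by have := prime_gt1 p_prime; rewrite ltnNge dvdn_leq// -g1 dvdn_gcd p_n.
have [N qN] := exists_pow_lt q01 e0.
have [u [v uv]] : exists u v : int, u * d%:Z + v * (p ^ N)%N%:Z = 1.
  have : coprimez d%:Z (p ^ N)%N%:Z by rewrite coprimezE coprimeXr// coprime_sym.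
  by case/coprimezP => -[u v] /= H; exists u, v.
set P : int := (p ^ N)%N%:Z in uv; have P0 : P != 0.
  by rewrite /P eqz_nat -lt0n expn_gt0 prime_gt0.
(* As [u] inverts [d] modulo [P], the product $nd$ is congruent to the numerator; $|d| = 1$ then
   lets the factor [d] be dropped. *)
pose m : int := u * numq x; pose n := `|(m %% P)%Z|%N; exists n.
have nE : n%:Z = m - (m %/ P)%Z * P.
  by rewrite /n gez0_abs ?modz_ge0// {2}(divz_eq m P) addrC addKr.
have ndE : n%:Z * d%:Z - numq x = (- numq x * v - (m %/ P)%Z * d%:Z) * P.
  rewrite nE /m -[X in _ - X]mulr1 -uv; ring.
have PE : Qp_abs T P%:~R = q ^+ N.
  by rewrite -[P%:~R]/((p ^ N)%:R) natrX absvX (padic_absv_p p_prime Qp_abs_nat).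
have ny : Qp_abs T (n%:R - y) <= q ^+ N.
  rewrite -[X in X <= _]mulr1 -(padic_absv_nat_eq1 p_prime Qp_abs_nat co_d).
  rewrite -absv_mul mulrBl yd -[n%:R]/(n%:Z%:~R) -[d%:R]/(d%:Z%:~R) -rmorphM -rmorphB.
  by rewrite ndE rmorphM absv_mul PE ler_piMl ?Qp_abs_int_le1// exprn_ge0// ltW.
have -> : n%:R - iota a = Cp_in T (Qpbar_in T (n%:R - padic_int_val a)).
  by rewrite /padic_int_in !rmorphB !rmorph_nat.
rewrite Cp_abs_Qp -(subrK y n%:R) -addrA; apply: absv_add_lt.
  exact: le_lt_trans ny qN.
by rewrite absv_subC.
Qed.

(** * Powers with exponent in $\mathbb{Z}_p$ *)

Section Pow.
Context (w : C) (hw : Cp_abs T (1 - w) < 1).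

Let w1 : Cp_abs T (w - 1) < 1.
Proof. by rewrite absv_subC. Qed.

Local Notation W := (padic_int_pow w).

(** The denominator $M+1$ stays positive when $M = 0$. *)
Let close_lt (M e x : R) : 0 <= M -> 0 <= x -> x < e / (M + 1) -> M * x < e.
Proof.
move=> M0 x0; rewrite ltr_pdivlMr ?ltr_wpDl// => /(le_lt_trans _); apply.
by rewrite mulrC ler_wpM2l// lerDl.
Qed.

(** Ensures that [xget] returns a true limit and not its default $0$. By the Lipschitz bound,
    $w^{s_i}$ is Cauchy along naturals $s_i \to a$, and its limit serves for all naturals near
    [a]. *)
Lemma padic_int_powP (a : Zp) (e : R) : 0 < e -> exists2 d : R, 0 < d &
  forall n : nat, Cp_abs T (n%:R - iota a) < d -> Cp_abs T (w ^+ n - W a) < e.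
Proof.
pose A (l : C) := forall e : R, 0 < e -> exists2 d : R, 0 < d &
    forall n : nat, padic_int_abs (n%:R - a) < d -> Cp_abs T (w ^+ n - l) < e.
have absE (n : nat) : padic_int_abs (n%:R - a) = Cp_abs T (n%:R - iota a).
  by rewrite -Cp_abs_iota rmorphB rmorph_nat.
suff [l Al] : exists l, A l.
  have HW : A (W a) by apply: xgetPex; exists l.
  move=> e0; have [d d0 Hd] := HW e e0; exists d => // n.
  by rewrite -absE; apply: Hd.
have [M M0 HM] := absv_pow_lipschitz p_prime Cp_abs_nat Cp_complete w1.
have /choice[s Hs] (i : nat) := padic_int_nat_dense a (exprn_gt0 i q_gt0).
have dist (e' : R) (m n : nat) : 0 < e' -> Cp_abs T (m%:R - iota a) < e' / (M + 1) ->
    Cp_abs T (n%:R - iota a) < e' / (M + 1) -> Cp_abs T (w ^+ m - w ^+ n) < e'.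
  move=> e0 ma na; apply: le_lt_trans (HM m n) _; apply: close_lt => //.
    exact: absv_ge0.
  by rewrite -(subrK (iota a) m%:R) -addrA absv_add_lt// absv_subC.
have close (e' : R) : 0 < e' -> exists N, forall i, (N <= i)%N ->
    Cp_abs T ((s i)%:R - iota a) < e' / (M + 1).
  move=> e0; have [N qN] := exists_pow_lt q01 (divr_gt0 e0 (ltr_wpDl M0 ltr01)).
  exists N => i Ni; apply: lt_trans (Hs i) _; apply: le_lt_trans qN.
  by case/andP: q01 => ? ?; rewrite ler_wiXn2l// ltW.
have [|l Hl] := @Cp_complete (fun i : nat => w ^+ s i).
  move=> e' e0; have [N HN] := close e' e0; exists N => m n Nm Nn.
  by apply: dist => //; apply: HN.
exists l => e' e0; exists (e' / (M + 1)); first by rewrite divr_gt0 ?ltr_wpDl.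
move=> n; rewrite absE => na.
have [N HN] := close e' e0; have [N' HN'] := Hl e' e0.
rewrite -(subrK (w ^+ s (maxn N N')) (w ^+ n)) -addrA; apply: absv_add_lt.
  by apply: dist => //; apply: HN; apply: leq_maxl.
by apply: HN'; apply: leq_maxr.
Qed.

Lemma padic_int_pow_approx (a : Zp) (e : R) : 0 < e -> exists2 n : nat,
  Cp_abs T (n%:R - iota a) < e & Cp_abs T (w ^+ n - W a) < e.
Proof.
move=> e0; have [d d0 Hd] := padic_int_powP a e0.
have m0 : 0 < Num.min e d by rewrite lt_min e0.
have [n] := padic_int_nat_dense a m0.
by rewrite lt_min => /andP[ne nd]; exists n => //; apply: Hd.
Qed.

Lemma padic_int_pow_nat n : W n%:R = w ^+ n.
Proof.
apply/esym/(absv_eq_of_lt (a := Cp_abs T)) => e e0.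
have [d d0] := padic_int_powP n%:R e0; apply.
by rewrite rmorph_nat subrr Cp_abs0.
Qed.

Lemma Cp_abs_pow (a : Zp) : Cp_abs T (W a) = 1.
Proof.
have [n _ nW] := padic_int_pow_approx a ltr01.
have wn1 : Cp_abs T (w ^+ n) = 1 by rewrite absvX (absv_eq1 w1) expr1n.
by rewrite (absv_eq_of_close (x := w ^+ n)) wn1.
Qed.

(** Additivity passes from natural exponents to the limit, since factors of absolute value $1$ do
    not enlarge errors. *)
Lemma padic_int_powD (a b : Zp) : W (a + b) = W a * W b.
Proof.
apply/(absv_eq_of_lt (a := Cp_abs T)) => e e0.
have [d d0 Hd] := padic_int_powP (a + b) e0.
have m0 : 0 < Num.min e d by rewrite lt_min e0.
have [n] := padic_int_pow_approx a m0; rewrite !lt_min => /andP[_ na] /andP[Wn _].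
have [m] := padic_int_pow_approx b m0; rewrite !lt_min => /andP[_ mb] /andP[Wm _].
rewrite -(subrK (w ^+ (n + m)) (W (a + b))) -addrA; apply: absv_add_lt.
  rewrite absv_subC; apply: Hd; rewrite natrD rmorphD opprD addrACA.
  exact: absv_add_lt.
rewrite (_ : _ - _ = w ^+ n * (w ^+ m - W b) + W b * (w ^+ n - W a)); last first.
  by rewrite exprD; ring.
by apply: absv_add_lt; rewrite absv_mul ?Cp_abs_pow ?absvX ?(absv_eq1 w1) ?expr1n mul1r.
Qed.

Lemma padic_int_in_eq0 (z : Zp) : (iota z == 0) = (z == 0).
Proof. by rewrite /padic_int_in !fmorph_eq0 -val_eqE. Qed.

Lemma padic_int_pow_linear : exists L, exists2 M, 0 <= M &
  forall z : Zp, Cp_abs T (W z - 1 - iota z * L) <= M * Cp_abs T (iota z) ^+ 2.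
Proof.
have [L [M M0 HM]] := absv_pow_linear p_prime Cp_abs_nat Cp_complete w1.
exists L, M => // z; have [->|z0] := eqVneq z 0.
  by rewrite -[0]/(0%:R) padic_int_pow_nat rmorph0 subrr mul0r subr0 Cp_abs0 mulr_ge0 ?exprn_ge0.
apply/ler_addgt0Pr => e e0; have L0 := absv_ge0 (Cp_abs T) L.
have B0 : 0 <= M * Cp_abs T (iota z) ^+ 2 by rewrite mulr_ge0 ?exprn_ge0 ?absv_ge0.
(* Distance below $|z|$ gives $|n| = |z|$, which is why $z = 0$ is treated apart; the bound $e$
   controls $W(z) - w^n$, and $e/(|L|+1)$ controls $(n-z)L$. *)
have d0 : 0 < Num.min (Cp_abs T (iota z)) (Num.min e (e / (Cp_abs T L + 1))).
  by rewrite !lt_min e0 absv_gt0 ?padic_int_in_eq0//= divr_gt0// ltr_wpDl.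
have [n] := padic_int_pow_approx z d0; rewrite !lt_min => /and3P[nz _ nL] /and3P[_ ne _].
rewrite absv_subC in nz; have nzE := absv_eq_of_close nz.
rewrite (_ : _ - _ = W z - w ^+ n + (w ^+ n - 1 - n%:R * L) + (n%:R - iota z) * L);
  last by ring.
apply: absv_add_le; first apply: absv_add_le.
- by rewrite absv_subC; apply: le_trans (ltW ne) _; rewrite lerDr.
- by apply: le_trans (HM n) _; rewrite nzE lerDl ltW.
- rewrite absv_mul mulrC ltW// (lt_le_trans (close_lt L0 _ nL)) ?absv_ge0//.
  by rewrite lerDr.
Qed.

(** A quantitative strengthening of uniform differentiability. The bounds on [F] and [F'] make it
    stable under products, and it yields the Lipschitz estimate used for the limit of the sums. *)
Definition quad_diff (F : Zp -> C) : Prop := exists F' : Zp -> C, exists2 M, 0 <= M &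
  [/\ forall x, Cp_abs T (F x) <= M, forall x, Cp_abs T (F' x) <= M &
      forall x y, Cp_abs T (F x - F y - iota (x - y) * F' y)
        <= M * Cp_abs T (iota (x - y)) ^+ 2].

Lemma lipschitz_of_quad (F F' : Zp -> C) (M : R) : 0 <= M ->
  (forall x, Cp_abs T (F' x) <= M) ->
  (forall x y, Cp_abs T (F x - F y - iota (x - y) * F' y)
    <= M * Cp_abs T (iota (x - y)) ^+ 2) ->
  forall x y, Cp_abs T (F x - F y) <= M * Cp_abs T (iota (x - y)).
Proof.
move=> M0 F'M FM x y; set z := iota _.
have z1 : Cp_abs T z <= 1 by apply: Cp_abs_iota_le1.
rewrite -(subrK (z * F' y) (F x - F y)); apply: absv_add_le.
  by apply: le_trans (FM x y) _; rewrite ler_wpM2l// expr2 ler_piMl ?absv_ge0.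
by rewrite absv_mul mulrC ler_wpM2r ?absv_ge0.
Qed.

Lemma quad_diff_lipschitz F : quad_diff F -> exists2 M, 0 <= M &
  forall x y, Cp_abs T (F x - F y) <= M * Cp_abs T (iota (x - y)).
Proof.
by move=> [F' [M M0 [_ F'M FM]]]; exists M => //; apply: lipschitz_of_quad FM.
Qed.

Lemma quad_diff_cst (c : C) : quad_diff (fun=> c).
Proof.
exists (fun=> 0), (Cp_abs T c); first exact: absv_ge0.
split=> [//|x|x y]; first by rewrite Cp_abs0 absv_ge0.
by rewrite subrr mulr0 subr0 Cp_abs0 mulr_ge0 ?exprn_ge0 ?absv_ge0.
Qed.

Lemma quad_diff_iota : quad_diff iota.
Proof.
exists (fun=> 1), 1 => //; split=> [x|x|x y]; rewrite ?absv_one ?Cp_abs_iota_le1//.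
by rewrite mulr1 -rmorphB subrr Cp_abs0 mul1r exprn_ge0 ?absv_ge0.
Qed.

Lemma quad_diffD F G : quad_diff F -> quad_diff G -> quad_diff (fun x => F x + G x).
Proof.
move=> [F' [M M0 [FM F'M FFM]]] [G' [N N0 [GN G'N GGN]]].
exists (fun x => F' x + G' x), (Num.max M N); first by rewrite le_max M0.
have [lM lN] : M <= Num.max M N /\ N <= Num.max M N by rewrite !le_max !lexx orbT.
split=> [x|x|x y].
- by apply: absv_add_le; [apply: le_trans lM | apply: le_trans lN].
- by apply: absv_add_le; [apply: le_trans lM | apply: le_trans lN].
rewrite (_ : _ - _ = F x - F y - iota (x - y) * F' y +
  (G x - G y - iota (x - y) * G' y)); last by ring.
by apply: absv_add_le; [apply: le_trans (FFM x y) _ | apply: le_trans (GGN x y) _];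
  rewrite ler_wpM2r ?exprn_ge0 ?absv_ge0.
Qed.

Lemma quad_diffM F G : quad_diff F -> quad_diff G -> quad_diff (fun x => F x * G x).
Proof.
move=> [F' [M M0 [FM F'M FFM]]] [G' [N N0 [GN G'N GGN]]].
exists (fun x => F' x * G x + F x * G' x), (M * N); first exact: mulr_ge0.
split=> [x|x|x y]; first by rewrite absv_mul ler_pM ?absv_ge0.
  by apply: absv_add_le; rewrite absv_mul ler_pM ?absv_ge0.
set z := iota (x - y).
(* In this splitting of the product rule the middle term is quadratic because [F] is Lipschitz. *)
rewrite (_ : _ - _ = F x * (G x - G y - z * G' y) + z * G' y * (F x - F y) +
  G y * (F x - F y - z * F' y)); last by ring.
have F_lip := lipschitz_of_quad M0 F'M FFM x y.
apply: absv_add_le; first apply: absv_add_le; rewrite absv_mul.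
- by rewrite -mulrA ler_pM ?absv_ge0.
- rewrite [leRHS](_ : _ = (Cp_abs T z * N) * (M * Cp_abs T z)); last by ring.
  by rewrite ler_pM ?absv_ge0// absv_mul ler_wpM2l ?absv_ge0.
- by rewrite [M * N]mulrC -mulrA ler_pM ?absv_ge0.
Qed.

Lemma quad_diff_horner (P : {poly C}) : quad_diff (fun x => P.[iota x]).
Proof.
elim/poly_ind: P => [|P c IHP].
  by under eq_fun do rewrite horner0; apply: quad_diff_cst.
under eq_fun do rewrite hornerMXaddC.
by apply: quad_diffD (quad_diff_cst c); apply: quad_diffM quad_diff_iota.
Qed.

Lemma quad_diff_shift F (c : Zp) : quad_diff F -> quad_diff (fun x => F (c + x)).
Proof.
move=> [F' [M M0 [FM F'M FFM]]]; exists (fun x => F' (c + x)), M => //.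
by split=> // x y; have := FFM (c + x) (c + y); rewrite opprD addrACA subrr add0r.
Qed.

(** The factorization $W(x) = W(y)W(x-y)$ carries the estimate at exponent $0$ to every point, with
    derivative $W(y)L$. *)
Lemma quad_diff_pow : quad_diff W.
Proof.
have [L [M M0 HM]] := padic_int_pow_linear.
exists (fun x => W x * L), (Num.max M (Num.max 1 (Cp_abs T L))).
  by rewrite le_max M0.
split=> [x|x|x y]; first by rewrite Cp_abs_pow !le_max lexx orbT.
  by rewrite absv_mul Cp_abs_pow mul1r !le_max lexx !orbT.
rewrite (_ : W x = W y * W (x - y)); last by rewrite -padic_int_powD addrC subrK.
rewrite (_ : _ - _ = W y * (W (x - y) - 1 - iota (x - y) * L)); last by ring.
rewrite absv_mul Cp_abs_pow mul1r; apply: le_trans (HM _) _.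
by rewrite ler_wpM2r ?exprn_ge0 ?absv_ge0// le_max lexx.
Qed.

(** Division by $x-y$ leaves an error of at most $M|x-y|$. *)
Lemma quad_diff_unif_differentiable F : quad_diff F -> unif_differentiable F.
Proof.
move=> [F' [M M0 [_ _ FM]]]; exists F' => e e0; exists (e / (M + 1)).
  by rewrite divr_gt0// ltr_wpDl.
move=> x y xy; rewrite -Cp_abs_iota; set z := iota (x - y) => zd.
have z0 : z != 0 by rewrite padic_int_in_eq0 subr_eq0.
rewrite (_ : _ - _ = (F x - F y - z * F' y) / z); last first.
  by rewrite [RHS]mulrBl [z * _]mulrC mulfK.
rewrite absv_mul absvV// ltr_pdivrMr ?absv_gt0//.
apply: le_lt_trans (FM x y) _; rewrite expr2 mulrA ltr_pM2r ?absv_gt0//.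
exact: close_lt (absv_ge0 _ _) zd.
Qed.

(** * Fermionic integrals of $w^a Q(a)$ *)

Section Integral.
Context (p_odd : odd p).

Lemma Cp_abs2 : Cp_abs T 2 = 1.
Proof.
by rewrite (padic_absv_nat_eq1 p_prime Cp_abs_nat)// coprimen2.
Qed.

(** For $w = -1$ one would have $|w-1| = |2| = 1$. Oddness of [p] thus makes $we^t+1$ invertible. *)
Lemma wD1_neq0 : w + 1 != 0.
Proof.
apply/eqP => wN1; move: w1.
have -> : w - 1 = w + 1 - 2 by ring.
by rewrite wN1 sub0r absvN Cp_abs2 ltxx.
Qed.

Lemma is_fermionic_pow_poly (c : Zp) (Q : {poly C}) :
  is_fermionic (fun a => W (c + a) * Q.[iota (c + a)])
    (W c * (fps_act (2 / (fps_wexp w + 1)) Q).[iota c]).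
Proof.
have qP P : quad_diff (fun x => W (c + x) * P.[iota (c + x)]).
  apply: (quad_diff_shift c (F := fun y => W y * P.[iota y])).
  exact: quad_diffM quad_diff_pow (quad_diff_horner P).
split; first exact: quad_diff_unif_differentiable (qP Q).
set E := fps_act _ Q => e e0.
pose H x := W (c + x) * E.[iota (c + x)].
have [M M0 HM] := quad_diff_lipschitz (qP E).
have W1 : W 1 = w by rewrite (padic_int_pow_nat 1).
(* The equation $wE(y+1)+E(y) = 2Q(y)$ at $y = c+n$, multiplied by $w^{c+n}$. *)
have step (n : nat) : 2 * (W (c + n%:R) * Q.[iota (c + n%:R)]) = H n.+1%:R + H n%:R.
  rewrite mulrCA -(horner_fps_act_euler (padic_pchar0 p_prime Cp_abs_nat) _ _ wD1_neq0).
  rewrite -/E /H -natr1 addrA (padic_int_powD (c + n%:R) 1) W1.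
  by rewrite [iota (_ + 1)]rmorphD rmorph1 mulrDr mulrA.
have telescope (n : nat) :
    2 * \sum_(0 <= a < n) W (c + a%:R) * Q.[iota (c + a%:R)] * (-1) ^+ a
    = H 0 - (-1) ^+ n * H n%:R.
  elim: n => [|n IHn]; first by rewrite big_geq// mulr0 mul1r subrr.
  by rewrite big_nat_recr//= mulrDr IHn mulrA step exprS; ring.
have n2 : 2 != 0 :> C by apply: (padic_nat_neq0 p_prime Cp_abs_nat).
have [N qN] := exists_pow_lt q01 (divr_gt0 e0 (ltr_wpDl M0 ltr01)).
(* Since $|2| = 1$, the difference may be doubled. As $(-1)^{p^n} = -1$, it becomes $H(p^n) - H(0)$,
   which the Lipschitz bound keeps below $M p^{-n}$ up to equality. *)
exists N => n Nn; rewrite /fermionic_sum -[X in X < _]mul1r -Cp_abs2 -absv_mul mulrBr.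
rewrite telescope -signr_odd oddX p_odd orbT mulN1r opprK.
rewrite (_ : _ - _ = H (p ^ n)%:R - H 0); last by rewrite /H addr0; ring.
apply: le_lt_trans (HM _ _) _; rewrite subr0 rmorph_nat; apply: close_lt => //.
  exact: absv_ge0.
rewrite natrX absvX (padic_absv_p p_prime Cp_abs_nat); apply: le_lt_trans qN.
by case/andP: q01 => ? ?; rewrite ler_wiXn2l// ltW.
Qed.

(** The base point [c] stays arbitrary because the inner integrals are taken at base point $c+a$;
    the outer integration then supplies the remaining factor of the operator. *)
Lemma is_multi_fermionic_pow_poly (k : nat) (c : Zp) (P : {poly C}) :
  is_multi_fermionic
    (fun s : k.-tuple Zp => W (c + \sum_(j < k) tnth s j) *
       P.[iota (c + \sum_(j < k) tnth s j)])
    (W c * (fps_act ((2 / (fps_wexp w + 1)) ^+ k) P).[iota c]).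
Proof.
elim: k c => [|k IHk] c; first by rewrite /= big_ord0 addr0 expr0 fps_act1.
set D := 2 / _ in IHk *; rewrite exprS fps_act_mul.
exists (fun a => W (c + a) * (fps_act (D ^+ k) P).[iota (c + a)]); last first.
  exact: is_fermionic_pow_poly.
move=> a; have := IHk (c + a); congr is_multi_fermionic; apply/funext => s.
have -> // : c + a + \sum_(j < k) tnth s j = c + \sum_(j < k.+1) tnth [tuple of a :: s] j.
rewrite big_ord_recl tnth0 addrA; congr (_ + _).
by apply: eq_bigr => j _; rewrite tnthS.
Qed.

End Integral.
End Pow.
End Tower.

Theorem theorem2p6 (R : realType) (p : nat) (p_prime : prime p) (p_odd : odd p)
    (T : padic_tower R p) (w : Cp T) (hw : Cp_abs T (1 - w) < 1)
    (k : nat) (hk : (1 <= k)%N) :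
  [/\ forall h : {poly Cp T},
        is_multi_fermionic_poly
          (fun a : k.-tuple (padic_int T) =>
             padic_int_pow w (\sum_(j < k) tnth a j) *:
               (h \Po ((padic_int_in (\sum_(j < k) tnth a j))%:P + 'X)))
          (fps_act ((2%:R / (fps_wexp w + 1)) ^+ k) h),
      exists J : fps (Cp T),
        is_multi_fermionic_fps
          (fun a : k.-tuple (padic_int T) =>
             fpsC (padic_int_pow w (\sum_(j < k) tnth a j)) *
               fps_exp (padic_int_in (\sum_(j < k) tnth a j)))
          J /\
        forall n : nat,
          weighted_euler w k n = fps_act ((2%:R / (fps_wexp w + 1)) ^+ k) 'X^n /\
          fps_act ((2%:R / (fps_wexp w + 1)) ^+ k) 'X^n = fps_act J 'X^n
    & is_sheffer (((fps_wexp w + 1) / 2%:R) ^+ k) (Fps (fun n => (n == 1%N)%:R))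
        (weighted_euler w k)].
Proof.
have charC := padic_pchar0 p_prime (Cp_abs_nat T).
have w1 := wD1_neq0 p_prime hw p_odd.
have W0 : padic_int_pow w 0 = 1 :> Cp T.
  by rewrite -[0]/(0%:R) (padic_int_pow_nat p_prime hw).
have iota0 : padic_int_in (0 : padic_int T) = 0 by rewrite /padic_int_in !rmorph0.
have int0 P := is_multi_fermionic_pow_poly p_prime hw p_odd k 0 P.
set D := (2 / _) ^+ k.
split; last exact: weighted_euler_sheffer.
(* The coefficient of $x^i$ in $h(c+x)$ is $h^{(i)}(c)/i!$, so the scalar formula is applied to this
   divided derivative. *)
- move=> h i; have := int0 h^`N(i); rewrite W0 iota0 mul1r -coef_fps_act.
  congr is_multi_fermionic; apply/funext => s.
  by rewrite add0r coefZ coef_comp_polyCaddX.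
(* The integrated exponential is [D] itself: for $P = x^n/n!$ the integrand is the coefficient of
   $t^n$ in the exponential series, and $D(t)P$ at $0$ is the coefficient of $t^n$ in [D]. *)
exists D; split=> [n|n]; last by rewrite (weighted_eulerE charC).
have := int0 (n`!%:R^-1 *: 'X^n); rewrite W0 iota0 mul1r.
rewrite fps_actZr hornerZ -fps_pair_act fps_pairXn mulKf; last first.
  by rewrite (padic_nat_neq0 p_prime (Cp_abs_nat T)) ?fact_gt0.
congr is_multi_fermionic; apply/funext => s; rewrite add0r fps_coefCM.
by congr (_ * _); rewrite hornerZ hornerXn mulrC.
Qed.
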